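(* The AMSY-Lie algebra $\mathfrak{G}$ associated to the Clingher–Doran family of $N$-polarized K3 surfaces is isomorphic to $\mathfrak{sp}_4(\mathbb{C})$.
   Context: Let $N=H\oplus E_8\oplus E_7$, a lattice of rank $17$. The Clingher–Doran family consists of the $N$-polarized K3 surfaces obtained as minimal resolutions of the quartics $y^2zw-4x^3z+3axzw^2+bzw^3+cxz^2w-\frac12(dz^2w^2+w^4)=0$ in $\mathbb{P}^3$, with $(a,b,c,d)\in\mathbb{C}^4$ and $c\neq0$ or $d\neq 0$. For such a surface $X$ with polarization $\iota$, the quotient $H^2_{dR}(X/\mathbb{C})/\iota(N)$ has dimension $5$. The intersection matrix chosen for this lattice is $$\Psi=\begin{bmatrix}0&0&0&0&1\\0&0&0&1&0\\0&0&-\frac12&0&0\\0&1&0&0&0\\1&0&0&0&0\end{bmatrix}.$$ Let $\mathsf{G}$ be the complex algebraic group of all $g\in\mathrm{Mat}_5(\mathbb{C})$ such that $g^T\Psi g=\Psi$ and $g^T$ respects the Hodge filtration, i.e. $g^T$ is block lower triangular with diagonal blocks of sizes $1,3,1$. The AMSY-Lie algebra $\mathfrak{G}$ associated to the Clingher–Doran family is the Lie subalgebra of $\mathfrak{gl}_5(\mathbb{C})$ generated by $\mathrm{Lie}(\mathsf{G})$ and $V_1^T,V_2^T,V_3^T$, where, with $E_{ij}$ the elementary matrices, $V_1=E_{12}-E_{45}$, $V_2=E_{13}+2E_{35}$, $V_3=E_{14}-E_{25}$ are elements of $\mathrm{Lie}(\mathsf{G})$ spanning its nilradical.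
   Formalization: The generator V_2^T = E_31 + 2E_53 is replaced by E_31 + (1/2)E_53; with the coefficient 2 it is not in the orthogonal Lie algebra of Psi and the generated Lie algebra is all of sl_5 (dimension 24), so the claim would fail. *)

(* Defs.v *)
From mathcomp Require Import all_boot all_order all_algebra.
From mathcomp Require Import reals complex mpoly.

Set Implicit Arguments.
Unset Strict Implicit.
Unset Printing Implicit Defensive.

Import GRing.Theory.
Local Open Scope ring_scope.

Section LieSubalgebras.
Variable F : fieldType.

Definition lie_bracket n (X Y : 'M[F]_n) : 'M[F]_n := X *m Y - Y *m X.

Definition is_lie_subalgebra n (L : 'M[F]_n -> Prop) : Prop :=
  [/\ L 0,
      forall (a : F) (X Y : 'M[F]_n), L X -> L Y -> L (a *: X + Y)
    & forall X Y : 'M[F]_n, L X -> L Y -> L (lie_bracket X Y)].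

Definition lie_generated n (S : 'M[F]_n -> Prop) (X : 'M[F]_n) : Prop :=
  forall L : 'M[F]_n -> Prop,
    is_lie_subalgebra L -> (forall Y, S Y -> L Y) -> L X.

(* [f] is a function on all of ['M_n], but only its values on [L] matter. *)
Definition lie_isomorphic n m
    (L : 'M[F]_n -> Prop) (L' : 'M[F]_m -> Prop) : Prop :=
  exists f : 'M[F]_n -> 'M[F]_m,
    [/\ forall (a : F) (X Y : 'M[F]_n), L X -> L Y ->
          f (a *: X + Y) = a *: f X + f Y,
        forall X Y : 'M[F]_n, L X -> L Y ->
          f (lie_bracket X Y) = lie_bracket (f X) (f Y),
        forall X, L X -> L' (f X),
        forall X Y : 'M[F]_n, L X -> L Y -> f X = f Y -> X = Y
      & forall Z, L' Z -> exists2 X, L X & f X = Z].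

(* Tangent space at the identity of the closed subvariety G of GL_n: the
   matrices X such that the differential at 1 of every polynomial function (in
   the n^2 matrix entries) vanishing on G is zero in the direction X. *)
Definition Lie n (G : 'M[F]_n -> Prop) (X : 'M[F]_n) : Prop :=
  forall p : {mpoly F[n * n]},
    (forall g, G g -> p.@[fun k => mxvec g 0 k] = 0) ->
    \sum_(k < n * n)
      (p^`M(k)).@[fun l => mxvec (1%:M : 'M[F]_n) 0 l] * mxvec X 0 k = 0.

Definition symplectic_form m : 'M[F]_(m + m) :=
  block_mx 0 1%:M (- 1%:M) 0.

(* sp_(2m), so that sp_4 is [sp 2]. *)
Definition sp m (X : 'M[F]_(m + m)) : Prop :=
  X^T *m symplectic_form m + symplectic_form m *m X = 0.

End LieSubalgebras.

Section ClingherDoran.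
Variable R : realType.
Local Notation C := R[i].

(* The elementary matrix E_ij, with indices running from 1 to 5. *)
Definition E (i j : nat) : 'M[C]_5 :=
  \matrix_(k, l) ((k.+1 == i) && (l.+1 == j))%:R.

Definition Psi : 'M[C]_5 :=
  E 1 5 + E 2 4 - 2^-1 *: E 3 3 + E 4 2 + E 5 1.

(* Index of the block (of sizes 1, 3, 1) containing a row or column. *)
Definition hodge_block (i : 'I_5) : nat :=
  if (i < 1)%N then 0%N else if (i < 4)%N then 1%N else 2%N.

Definition block_lower_triangular (A : 'M[C]_5) : Prop :=
  forall i j, (hodge_block i < hodge_block j)%N -> A i j = 0.

Definition cdG (g : 'M[C]_5) : Prop :=
  g^T *m Psi *m g = Psi /\ block_lower_triangular g^T.

Definition V1 : 'M[C]_5 := E 1 2 - E 4 5.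
Definition V3 : 'M[C]_5 := E 1 4 - E 2 5.

(* V2 = E 1 3 + 2 *: E 3 5 is the element of Lie(G) with first row E_13, but,
   unlike V1^T and V3^T, its transpose is not infinitesimally orthogonal for
   Psi: together with Lie(G) it generates all of sl_5.  The matrix of the
   second modular vector field has to satisfy Y2 *m Psi + Psi *m Y2^T = 0,
   which forces the coefficient 1/2 in place of 2. *)
Definition Y2 : 'M[C]_5 := E 1 3 + 2^-1 *: E 3 5.

Definition amsy_generator (X : 'M[C]_5) : Prop :=
  [\/ Lie cdG X, X = V1^T, X = Y2^T | X = V3^T].

Definition amsy : 'M[C]_5 -> Prop := lie_generated amsy_generator.

End ClingherDoran.

(* Main.v *)
(** The AMSY-Lie algebra is the full orthogonal Lie algebra of [Psi], and the
isomorphism is the exceptional one B2 = C2.  Each element V of the nilradical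
is tangent at 1 to the curve 1 + tV + t^2 V^2/2, which lies in the group, while
differentiating [g^T Psi g = Psi] bounds Lie(G) from above by so(Psi); the
nilradical, the three transposed generators and their brackets then span
so(Psi).  On the other side sp_4 acts on the primitive part of the exterior
square of C^4, where the wedge product is an invariant symmetric form with Gram
matrix proportional to [Psi] in a suitable basis. *)

From HB Require Import structures.
Require Import Defs.
From mathcomp Require Import all_boot all_order all_algebra.
From mathcomp Require Import reals complex mpoly ring.

Set Implicit Arguments.
Unset Strict Implicit.
Unset Printing Implicit Defensive.

Import GRing.Theory Num.Theory.
Local Open Scope ring_scope.

(** * Directional derivatives of polynomials and the chain rule along polynomial curves *)

Section DirectionalDerivative.
Variables (F : comNzRingType) (n : nat).
Implicit Types (p q : {mpoly F[n]}) (x v : 'I_n -> F).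

(** With the entries of 1 for [x] and those of X for [v], this is the sum occurring in [Lie]. *)
Definition mdir_deriv x v p : F := \sum_(k < n) p^`M(k).@[x] * v k.

Lemma mdir_deriv_is_linear x v : scalar (mdir_deriv x v).
Proof.
move=> c p q; rewrite /mdir_deriv mulr_sumr -big_split /=.
by apply: eq_bigr => k _; rewrite mderivD mderivZ mevalD mevalZ mulrDl mulrA.
Qed.

HB.instance Definition _ x v :=
  GRing.isLinear.Build F {mpoly F[n]} F _ (mdir_deriv x v)
    (mdir_deriv_is_linear x v).

Lemma mdir_derivM x v p q :
  mdir_deriv x v (p * q) =
  mdir_deriv x v p * q.@[x] + p.@[x] * mdir_deriv x v q.
Proof.
rewrite /mdir_deriv mulr_suml mulr_sumr -big_split /=.
apply: eq_bigr => k _; rewrite mderivM mevalD !mevalM mulrDl mulrA.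
by rewrite [_ * v k * _]mulrAC.
Qed.

Lemma mdir_derivC x v c : mdir_deriv x v c%:MP = 0.
Proof. by rewrite /mdir_deriv big1 // => k _; rewrite mderivC meval0 mul0r. Qed.

Lemma mdir_derivX x v i : mdir_deriv x v 'X_i = v i.
Proof.
rewrite /mdir_deriv (bigD1 i) //= big1 ?addr0 => [|k nki].
  rewrite mderivX mnm1E eqxx scale1r mevalX big1 ?mul1r // => j _.
  by rewrite mnmBE subnn expr0.
by rewrite mderivX mnm1E eq_sym (negbTE nki) scale0r meval0 mul0r.
Qed.

Definition mcurve (h : 'I_n -> {poly F}) p : {poly F} := mmap polyC h p.

Lemma mcurve_horner h p t : (mcurve h p).[t] = p.@[fun k => (h k).[t]].
Proof.
rewrite /mcurve /mmap horner_sum mevalE; apply: eq_bigr => m _.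
rewrite hornerM hornerC /mmap1 horner_prod; congr (_ * _).
by apply: eq_bigr => i _; rewrite horner_exp.
Qed.

(** Both sides are additive in [p] and obey the same Leibniz rule, so it suffices to compare them on
    constants and variables. *)
Lemma mcurve_deriv h p t :
  (mcurve h p)^`().[t] =
  mdir_deriv (fun k => (h k).[t]) (fun k => (h k)^`().[t]) p.
Proof.
set D := mdir_deriv _ _.
pose P q := (mcurve h q)^`().[t] = D q.
have PD q r : P q -> P r -> P (q + r).
  rewrite /P /D raddfD /= => <- <-.
  by rewrite /mcurve rmorphD derivD hornerD.
have PM q r : P q -> P r -> P (q * r).
  rewrite /P /D mdir_derivM => <- <-.
  by rewrite /mcurve rmorphM derivM hornerD !hornerM -!mcurve_horner.
have PC c : P c%:MP by rewrite /P /D mdir_derivC /mcurve mmapC derivC horner0.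
have PX i : P 'X_i by rewrite /P /D mdir_derivX /mcurve mmapX mmap1U.
elim/mpolyind: p => [|c m q _ _ IHq]; first exact: PC.
apply: PD IHq; rewrite -mul_mpolyC; apply: (PM) => //; rewrite mpolyXE_id.
apply: (big_ind P) => [||i _]; [exact: (PC 1)|exact: PM|].
by elim: (m i) => [|e IHe]; [exact: (PC 1)|rewrite exprS; apply: PM].
Qed.

End DirectionalDerivative.

(** * Tangent spaces of matrix groups, bounded from below and from above *)

Lemma poly0_horner (F : numFieldType) (p : {poly F}) :
  (forall t, p.[t] = 0) -> p = 0.
Proof.
move=> p0; apply: (@roots_geq_poly_eq0 _ _ [seq i%:R | i <- iota 0 (size p)]).
- by apply/allP => t _; apply/eqP.
- by rewrite map_inj_uniq ?iota_uniq // => i j /eqP; rewrite eqr_nat => /eqP.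
- by rewrite size_map size_iota.
Qed.

(** A polynomial vanishing on [G] restricts to the zero polynomial on the curve, having infinitely
    many roots; the chain rule at t = 0 then kills its derivative in the direction [V]. *)
Lemma Lie_curve (F : numFieldType) n (G : 'M[F]_n -> Prop) (V W : 'M[F]_n) :
  (forall t, G (1%:M + t *: V + t ^+ 2 *: W)) -> Lie G V.
Proof.
move=> Gt p p0.
pose h k : {poly F} := (mxvec (1%:M : 'M[F]_n) 0 k)%:P + (mxvec V 0 k)%:P * 'X
  + (mxvec W 0 k)%:P * 'X^2.
have ht t k : (h k).[t] = mxvec (1%:M + t *: V + t ^+ 2 *: W) 0 k.
  rewrite /h !linearD !linearZ /=; move: (mxvec _) (mxvec V) (mxvec W) => a b c.
  by rewrite !mxE !(hornerD, hornerM, hornerC, hornerX); ring.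
have q0 : mcurve h p = 0.
  apply: poly0_horner => t; rewrite mcurve_horner.
  by rewrite -[RHS](p0 _ (Gt t)); apply: meval_eq => k; rewrite ht.
have := mcurve_deriv h p 0; rewrite q0 deriv0 horner0 => /esym.
rewrite /mdir_deriv => D0; rewrite -[RHS]D0; apply: eq_bigr => k _.
congr (_ * _).
  by apply: meval_eq => l; rewrite ht scale0r expr0n scale0r !addr0.
rewrite /h !(derivD, derivM, derivC, derivX).
by rewrite !(hornerD, hornerM, hornerC, hornerX); ring.
Qed.

(** Each entry of g^T M g - M is a polynomial vanishing on [G], and its differential at 1 in the
    direction [X] is the same entry of X^T M + M X. *)
Lemma Lie_isometry (F : fieldType) n (M : 'M[F]_n) (G : 'M[F]_n -> Prop) X :
  (forall g, G g -> g^T *m M *m g = M) -> Lie G X -> X^T *m M + M *m X = 0.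
Proof.
move=> GM LX; apply/matrixP => i j.
pose Y a b : {mpoly F[n * n]} := 'X_(mxvec_index a b).
pose p := \sum_b (\sum_a Y a i * (M a b)%:MP) * Y b j - (M i j)%:MP.
have pg g : p.@[fun k => mxvec g 0 k] = (g^T *m M *m g) i j - M i j.
  rewrite /p mevalB mevalC mxE raddf_sum /=; congr (_ - _).
  apply: eq_bigr => b _; rewrite mevalM mevalXU mxvecE mxE raddf_sum /=.
  congr (_ * _); apply: eq_bigr => a _.
  by rewrite mevalM mevalXU mevalC mxvecE !mxE.
have /LX : forall g, G g -> p.@[fun k => mxvec g 0 k] = 0.
  by move=> g /GM gM; rewrite pg gM subrr.
rewrite -/(mdir_deriv _ _ _) {pg}/p raddfB /= mdir_derivC subr0 raddf_sum.
(* Writing the goal as X^T M 1 + 1^T M X matches it term by term with the product rule. *)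
move=> p0; rewrite [RHS]mxE -[RHS]p0 -{1}[M]mulmx1 mulmxA.
rewrite -{2}[M]mul1mx -{2}trmx1 !mxE -big_split /=.
apply: eq_bigr => b _; rewrite mdir_derivM !raddf_sum /= mdir_derivX mevalXU.
rewrite !mxvecE !mxE; congr (_ * _ + _ * _); apply: eq_bigr => a _.
  by rewrite mdir_derivM mdir_derivX mdir_derivC mevalC mulr0 addr0 !mxE mxvecE.
by rewrite mevalM mevalXU mevalC !mxvecE !mxE.
Qed.

(** Serves both for so(Psi) and for sp_4. *)
Lemma form_lie_subalgebra (F : fieldType) n (M : 'M[F]_n) :
  is_lie_subalgebra (fun X => X^T *m M + M *m X = 0).
Proof.
have formE (X : 'M[F]_n) : X^T *m M + M *m X = 0 -> X^T *m M = - (M *m X).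
  by move/eqP; rewrite addr_eq0 => /eqP.
split=> [|a X Y X0 Y0|X Y /formE X0 /formE Y0].
- by rewrite trmx0 mul0mx mulmx0 addr0.
- rewrite linearP mulmxDl mulmxDr -scalemxAl -scalemxAr addrACA -scalerDr.
  by rewrite X0 Y0 scaler0 addr0.
rewrite /lie_bracket linearB /= !trmx_mul mulmxBl mulmxBr -!mulmxA X0 Y0.
by rewrite !mulmxN !mulmxA X0 Y0 !mulNmx !opprK -!mulmxA addrC subrKA subrr.
Qed.

(** * Explicit indices for entrywise computations *)

(* [pk] and [qk] are the k-th indices in dimensions 2 and 5, counted from 1. *)
Local Notation p1 := (@Ordinal 2 0 isT).
Local Notation p2 := (@Ordinal 2 1 isT).
Local Notation q1 := (@Ordinal 5 0 isT).
Local Notation q2 := (@Ordinal 5 1 isT).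
Local Notation q3 := (@Ordinal 5 2 isT).
Local Notation q4 := (@Ordinal 5 3 isT).
Local Notation q5 := (@Ordinal 5 4 isT).

Lemma ord2_ind (P : 'I_2 -> Prop) : P p1 -> P p2 -> forall i, P i.
Proof. by move=> P1 P2 [[|[|//]]] i; rewrite (bool_irrelevance i isT). Qed.

Lemma ord5_ind (P : 'I_5 -> Prop) :
  P q1 -> P q2 -> P q3 -> P q4 -> P q5 -> forall i, P i.
Proof.
move=> P1 P2 P3 P4 P5 [[|[|[|[|[|//]]]]]] i.
all: by rewrite (bool_irrelevance i isT).
Qed.

Lemma sum_ord2 (V : nmodType) (f : 'I_2 -> V) : \sum_i f i = f p1 + f p2.
Proof.
by rewrite !big_ord_recl big_ord0 addr0; congr (f _ + f _); apply: val_inj.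
Qed.

Lemma sum_ord5 (V : nmodType) (f : 'I_5 -> V) :
  \sum_i f i = f q1 + f q2 + f q3 + f q4 + f q5.
Proof.
rewrite !big_ord_recl big_ord0 addr0 !addrA.
by do 4?congr (_ + _); congr f; apply: val_inj.
Qed.

(** * The exceptional correspondence between sp_4 and so_5 *)

Section Exterior.
Variable F : numFieldType.

Definition mx_of_rows n (s : seq (seq F)) : 'M[F]_n :=
  \matrix_(i, j) nth 0 (nth [::] s i) j.

Lemma mx_of_rowsE n s i j : mx_of_rows n s i j = nth 0 (nth [::] s i) j.
Proof. by rewrite mxE. Qed.

Lemma lie_bracketE n (X Y : 'M[F]_n) i j :
  lie_bracket X Y i j = \sum_k (X i k * Y k j - Y i k * X k j).
Proof. by rewrite !mxE sumrB. Qed.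

(* Action of [Z] in sp_4, with symplectic basis e1, e2, f1, f2, on the basis
   e1 /\ e2, e1 /\ f2, (e1 /\ f1 - e2 /\ f2) / 2, - e2 /\ f1, - f1 /\ f2 of
   the primitive part of the exterior square: there the Gram matrix of the
   wedge product is [- Psi]. *)
Definition ext_square (Z : 'M[F]_(2 + 2)) : 'M[F]_5 :=
  let a := ulsubmx Z in let b := ursubmx Z in let c := dlsubmx Z in
  mx_of_rows 5
   [:: [:: a p1 p1 + a p2 p2; b p2 p2; b p1 p2; b p1 p1; 0];
       [:: c p2 p2; a p1 p1 - a p2 p2; - a p1 p2; 0;
           - b p1 p1];
       [:: 2 * c p1 p2; - (2 * a p2 p1); 0; - (2 * a p1 p2);
           2 * b p1 p2];
       [:: c p1 p1; 0; - a p2 p1; a p2 p2 - a p1 p1;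
           - b p2 p2];
       [:: 0; - c p1 p1; c p1 p2; - c p2 p2;
           - (a p1 p1 + a p2 p2)]].

(** Inverse of [ext_square] on so(Psi). The ten entries read here are free coordinates on so(Psi),
    and the block shape puts every value in sp_4. *)
Definition ext_root (X : 'M[F]_5) : 'M[F]_(2 + 2) :=
  let A := mx_of_rows 2
    [:: [:: (X q1 q1 + X q2 q2) / 2; - X q2 q3];
        [:: - X q4 q3; (X q1 q1 - X q2 q2) / 2]] in
  let B := mx_of_rows 2 [:: [:: X q1 q4; X q1 q3];
                            [:: X q1 q3; X q1 q2]] in
  let C := mx_of_rows 2 [:: [:: X q4 q1; X q5 q3];
                            [:: X q5 q3; X q2 q1]] in
  block_mx A B C (- A^T).

Lemma ext_root_linear : linear ext_root.
Proof.
move=> k X Y; rewrite /ext_root scale_block_mx add_block_mx.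
by congr block_mx; apply/matrixP; do 2!elim/ord2_ind; rewrite !mxE /=; ring.
Qed.

Lemma spP (Z : 'M[F]_(2 + 2)) :
  sp Z <-> exists A B C : 'M[F]_2,
    [/\ Z = block_mx A B C (- A^T), B^T = B & C^T = C].
Proof.
rewrite /sp /symplectic_form; split=> [|[A [B [C [-> Bs Cs]]]]].
  rewrite -[Z]submxK; set A := ulsubmx Z; set B := ursubmx Z.
  set C := dlsubmx Z; set D := drsubmx Z.
  rewrite tr_block_mx !mulmx_block add_block_mx => /eqP.
  rewrite !(mulmx0, mul0mx, mulmx1, mul1mx, mulmxN, mulNmx) !(addr0, add0r).
  rewrite block_mx_eq0 => /and4P[/eqP Cs /eqP DA _ /eqP Bs].
  (* The four blocks gave C = C^T, D = - A^T (twice, up to transposition) and B = B^T. *)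
  exists A, B, C; split; last by apply/esym/eqP; rewrite -subr_eq0 addrC Cs.
    by congr block_mx; apply/eqP; rewrite -addr_eq0 addrC DA.
  by apply/eqP; rewrite -subr_eq0 Bs.
rewrite tr_block_mx !mulmx_block add_block_mx [(- A^T)^T]linearN /= trmxK.
rewrite !(mulmx0, mul0mx, mulmx1, mul1mx, mulmxN, mulNmx) !(addr0, add0r).
rewrite Bs Cs opprK subrr addrN subrr addNr.
by apply/eqP; rewrite block_mx_eq0 !eqxx.
Qed.

Lemma ext_root_sp X : sp (ext_root X).
Proof.
apply/spP; do 3!eexists; split; first by [].
  by apply/matrixP; do 2!elim/ord2_ind; rewrite !mxE.
by apply/matrixP; do 2!elim/ord2_ind; rewrite !mxE.
Qed.

Lemma ext_squareK Z : sp Z -> ext_root (ext_square Z) = Z.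
Proof.
case/spP=> A [B [C [-> /matrixP Bs /matrixP Cs]]].
(* [ext_root] fills both off-diagonal places of B, and of C, from a single entry, so the symmetry of
   these blocks is what recovers Z. *)
have := Bs p1 p2; have := Cs p1 p2; rewrite !mxE => C12 B12.
rewrite /ext_root /ext_square block_mxKul block_mxKur block_mxKdl.
by congr (block_mx _ _ _ (- _^T)); apply/matrixP; do 2!elim/ord2_ind;
  rewrite !mx_of_rowsE /= ?C12 ?B12; field.
Qed.

(** [ext_square] is a representation of sp_4; this is checked as 25 polynomial identities, once the
    off-diagonal entries of the symmetric blocks are identified. *)
Lemma ext_square_bracket Z W : sp Z -> sp W ->
  ext_square (lie_bracket Z W) = lie_bracket (ext_square Z) (ext_square W).
Proof.
case/spP=> A [B [C [-> /matrixP Bs /matrixP Cs]]].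
case/spP=> A' [B' [C' [-> /matrixP Bs' /matrixP Cs']]].
have := Bs p1 p2; have := Cs p1 p2; rewrite !mxE => C12 B12.
have := Bs' p1 p2; have := Cs' p1 p2; rewrite !mxE => C12' B12'.
rewrite {1}/lie_bracket !mulmx_block opp_block_mx add_block_mx /ext_square.
rewrite !(block_mxKul, block_mxKur, block_mxKdl).
apply/matrixP => i j; rewrite lie_bracketE sum_ord5 !mx_of_rowsE.
elim/ord5_ind: i; elim/ord5_ind: j => /=.
all: rewrite ?mxE ?sum_ord2 ?mxE ?C12 ?B12 ?C12' ?B12'.
all: ring.
Qed.

End Exterior.

(** * The orthogonal Lie algebra of [Psi] in coordinates *)

Section Orthogonal.
Variable R : realType.
Local Notation C := R[i].
Implicit Type X : 'M[C]_5.

Definition so_Psi X : Prop := X^T *m Psi R + Psi R *m X = 0.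

Definition Psi_coef (i : 'I_5) : C := if i == q3 then - 2^-1 else 1.

Lemma PsiE i j : Psi R i j = if j == rev_ord i then Psi_coef i else 0.
Proof.
elim/ord5_ind: i; elim/ord5_ind: j;
  by rewrite !mxE /= ?(mulr0, mulr1, subr0, addr0, add0r, oppr0).
Qed.

Lemma mulPsi n (Y : 'M[C]_(5, n)) i j :
  (Psi R *m Y) i j = Psi_coef i * Y (rev_ord i) j.
Proof.
rewrite mxE (bigD1 (rev_ord i)) //= PsiE eqxx big1 ?addr0 // => k nk.
by rewrite PsiE (negbTE nk) mul0r.
Qed.

Lemma tr_Psi : (Psi R)^T = Psi R.
Proof.
by apply/matrixP; elim/ord5_ind; elim/ord5_ind; rewrite mxE !PsiE.
Qed.

Lemma so_PsiP X : so_Psi X <-> forall i j,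
  Psi_coef j * X (rev_ord j) i + Psi_coef i * X (rev_ord i) j = 0.
Proof.
have e i j : (X^T *m Psi R + Psi R *m X) i j =
    Psi_coef j * X (rev_ord j) i + Psi_coef i * X (rev_ord i) j.
  by rewrite mxE mulPsi -[Psi R in LHS]tr_Psi -trmx_mul mxE mulPsi.
split=> [X0 i j|X0]; first by rewrite -e X0 mxE.
by apply/matrixP => i j; rewrite e X0 mxE.
Qed.

Lemma ext_square_so Z : so_Psi (ext_square Z).
Proof.
apply/so_PsiP; elim/ord5_ind; elim/ord5_ind;
  by rewrite !mx_of_rowsE /Psi_coef /=; field.
Qed.

Lemma rev_ord5 : (rev_ord q1 = q5) * (rev_ord q2 = q4) * (rev_ord q3 = q3) *
  (rev_ord q4 = q2) * (rev_ord q5 = q1).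
Proof. by do !split; apply: val_inj. Qed.

(** These 15 relations leave exactly the ten entries read by [ext_root]. *)
Lemma so_coords X : so_Psi X ->
  [/\ [/\ X q1 q5 = 0, X q2 q4 = 0, X q3 q3 = 0, X q4 q2 = 0 & X q5 q1 = 0],
      [/\ X q5 q2 = - X q4 q1, X q5 q4 = - X q2 q1, X q5 q5 = - X q1 q1,
          X q4 q4 = - X q2 q2 & X q4 q5 = - X q1 q2],
      X q2 q5 = - X q1 q4
    & [/\ X q3 q1 = 2 * X q5 q3, X q3 q2 = 2 * X q4 q3, X q3 q4 = 2 * X q2 q3
        & X q3 q5 = 2 * X q1 q3]].
Proof.
move=> /so_PsiP h.
(* Each relation is one entry (i, j) of the defining equation; the factor [k] normalises its
   coefficient, which involves -1/2 when an index is 3. *)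
have solve k i j (a b : C) : a - b =
    k * (Psi_coef j * X (rev_ord j) i + Psi_coef i * X (rev_ord i) j) -> a = b.
  by rewrite h mulr0 => /eqP; rewrite subr_eq0 => /eqP.
by split; [split|split| |split];
  [apply: (solve 2^-1 q5 q5)|apply: (solve 2^-1 q4 q4)|
   apply: (solve (- 1) q3 q3)|apply: (solve 2^-1 q2 q2)|
   apply: (solve 2^-1 q1 q1)|apply: (solve 1 q1 q2)|
   apply: (solve 1 q1 q4)|apply: (solve 1 q1 q5)|
   apply: (solve 1 q2 q4)|apply: (solve 1 q2 q5)|
   apply: (solve 1 q4 q5)|apply: (solve (- 2) q1 q3)|
   apply: (solve (- 2) q2 q3)|apply: (solve (- 2) q4 q3)|
   apply: (solve (- 2) q5 q3)];
  rewrite !rev_ord5 /Psi_coef /=; field.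
Qed.

Lemma ext_rootK X : so_Psi X -> ext_square (ext_root X) = X.
Proof.
case/so_coords=> [[e15 e24 e33 e42 e51] [e52 e54 e55 e44 e45] e25].
case=> e31 e32 e34 e35.
rewrite /ext_square /ext_root block_mxKul block_mxKur block_mxKdl.
rewrite !mx_of_rowsE /=; apply/matrixP => i j; rewrite mx_of_rowsE.
elim/ord5_ind: i; elim/ord5_ind: j => /=.
all: by rewrite ?(e15, e24, e33, e42, e51, e52, e54, e55, e44, e45, e25, e31,
  e32, e34, e35); field.
Qed.

(** * Generation of so(Psi) by the nilradical and the transposed generators *)

(* The paper's [V_2]; unlike it, [Y2] itself does not lie in [Lie cdG]. *)
Definition V2 : 'M[C]_5 := E R 1 3 + 2 *: E R 3 5.

(** For V = x V1 + y V2 + z V3 one has V^2 / 2 = (y^2 - xz) E_15 and V^3 = 0, so the curve is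
    exp(tV). *)
Lemma Lie_cdG_nilradical (x y z : C) :
  Lie (@cdG R) (x *: V1 R + y *: V2 + z *: V3 R).
Proof.
apply: (@Lie_curve _ _ _ _ ((y ^+ 2 - x * z) *: E R 1 5)) => t.
have -> : 1%:M + t *: (x *: V1 R + y *: V2 + z *: V3 R)
    + t ^+ 2 *: ((y ^+ 2 - x * z) *: E R 1 5) =
  mx_of_rows 5 [:: [:: 1; t * x; t * y; t * z; t ^+ 2 * (y ^+ 2 - x * z)];
                   [:: 0; 1; 0; 0; - (t * z)];
                   [:: 0; 0; 1; 0; 2 * (t * y)];
                   [:: 0; 0; 0; 1; - (t * x)];
                   [:: 0; 0; 0; 0; 1]].
  by apply/matrixP; elim/ord5_ind; elim/ord5_ind;
    rewrite mx_of_rowsE /= !mxE /=; ring.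
split.
  apply/matrixP => i j; rewrite -mulmxA mxE sum_ord5 !mulPsi !rev_ord5 PsiE.
  rewrite ![_^T _ _]mxE !mx_of_rowsE /Psi_coef.
  by elim/ord5_ind: i; elim/ord5_ind: j => /=; field.
move=> i j; rewrite mxE mx_of_rowsE.
by elim/ord5_ind: i; elim/ord5_ind: j.
Qed.

Lemma trE i j : (E R i j)^T = E R j i.
Proof. by apply/matrixP => k l; rewrite !mxE andbC. Qed.

(** The range condition matters because [E] is the zero matrix when an index is outside 1..5. *)
Lemma mulEE i j k l : (0 < j <= 5)%N ->
  E R i j *m E R k l = (j == k)%:R *: E R i l.
Proof.
case: j => // j j5; apply/matrixP => p q; rewrite !mxE.
rewrite (bigD1 (Ordinal j5)) //= big1 ?addr0 => [|r nr].
  by rewrite !mxE /= eqxx andbT -!natrM !mulnb andbCA.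
by rewrite !mxE eqSS [_ == j]negbTE ?andbF ?mul0r.
Qed.

(** This bracket and the next three form a basis of the block-diagonal part of so(Psi), of dimension
    4. *)
Lemma bracket_V1T_V2 :
  lie_bracket (V1 R)^T V2 = E R 2 3 + 2 *: E R 3 4.
Proof.
rewrite /lie_bracket /V1 /V2 linearB /= !trE.
rewrite !(mulmxBl, mulmxBr, mulmxDl, mulmxDr) -?(scalemxAl, scalemxAr).
rewrite !mulEE //= !(scale0r, scale1r, scaler0, subr0, addr0, add0r, sub0r).
by rewrite ?opprD !opprK ?addrA.
Qed.

Lemma bracket_V3T_V2 :
  lie_bracket (V3 R)^T V2 = E R 4 3 + 2 *: E R 3 2.
Proof.
rewrite /lie_bracket /V3 /V2 linearB /= !trE.
rewrite !(mulmxBl, mulmxBr, mulmxDl, mulmxDr) -?(scalemxAl, scalemxAr).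
rewrite !mulEE //= !(scale0r, scale1r, scaler0, subr0, addr0, add0r, sub0r).
by rewrite ?opprD !opprK ?addrA.
Qed.

Lemma bracket_V1_V1T :
  lie_bracket (V1 R) (V1 R)^T = E R 1 1 + E R 4 4 - E R 2 2 - E R 5 5.
Proof.
rewrite /lie_bracket /V1 linearB /= !trE.
rewrite !(mulmxBl, mulmxBr, mulmxDl, mulmxDr) -?(scalemxAl, scalemxAr).
rewrite !mulEE //= !(scale0r, scale1r, scaler0, subr0, addr0, add0r, sub0r).
by rewrite ?opprD !opprK ?addrA.
Qed.

Lemma bracket_V3_V3T :
  lie_bracket (V3 R) (V3 R)^T = E R 1 1 + E R 2 2 - E R 4 4 - E R 5 5.
Proof.
rewrite /lie_bracket /V3 linearB /= !trE.
rewrite !(mulmxBl, mulmxBr, mulmxDl, mulmxDr) -?(scalemxAl, scalemxAr).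
rewrite !mulEE //= !(scale0r, scale1r, scaler0, subr0, addr0, add0r, sub0r).
by rewrite ?opprD !opprK ?addrA.
Qed.

(** so(Psi) is a Lie subalgebra containing the generators, and [amsy] lies in every such
    subalgebra. *)
Lemma amsy_so X : amsy X -> so_Psi X.
Proof.
apply; first exact: form_lie_subalgebra.
move=> Y [LY|->|->|->]; first exact: Lie_isometry (fun g => @proj1 _ _) LY.
all: apply/so_PsiP; elim/ord5_ind; elim/ord5_ind.
all: by rewrite !rev_ord5 /Psi_coef !mxE /=; field.
Qed.

Lemma so_amsy X : so_Psi X -> amsy X.
Proof.
move=> /so_coords[[e15 e24 e33 e42 e51] [e52 e54 e55 e44 e45] e25].
case=> e31 e32 e34 e35 L subL genL.
have [L0 LP LB] := subL.
have LD Y Z : L Y -> L Z -> L (Y + Z).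
  by move=> LY LZ; rewrite -[Y]scale1r; apply: LP.
have LZ k Y : L Y -> L (k *: Y) by move=> LY; rewrite -[_ *: _]addr0; apply: LP.
have LV x y z : L (x *: V1 R + y *: V2 + z *: V3 R).
  by apply: genL; constructor 1; apply: Lie_cdG_nilradical.
have LV1 : L (V1 R) by have := LV 1 0 0; rewrite scale1r !scale0r !addr0.
have LV2 : L V2 by have := LV 0 1 0; rewrite scale1r !scale0r add0r addr0.
have LV3 : L (V3 R) by have := LV 0 0 1; rewrite scale1r !scale0r !add0r.
have LV1T : L (V1 R)^T by apply: genL; constructor 2.
have LY2T : L (Y2 R)^T by apply: genL; constructor 3.
have LV3T : L (V3 R)^T by apply: genL; constructor 4.
(* Ten basis vectors: three above the diagonal blocks, three below, four inside. The last two
   coefficients solve for the diagonal entries X_11 and X_22. *)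
have -> : X = X q1 q2 *: V1 R + X q1 q3 *: V2 + X q1 q4 *: V3 R
  + X q2 q1 *: (V1 R)^T + X q3 q1 *: (Y2 R)^T + X q4 q1 *: (V3 R)^T
  + X q2 q3 *: lie_bracket (V1 R)^T V2 + X q4 q3 *: lie_bracket (V3 R)^T V2
  + ((X q1 q1 - X q2 q2) / 2) *: lie_bracket (V1 R) (V1 R)^T
  + ((X q1 q1 + X q2 q2) / 2) *: lie_bracket (V3 R) (V3 R)^T.
  rewrite bracket_V1T_V2 bracket_V3T_V2 bracket_V1_V1T bracket_V3_V3T.
  apply/matrixP => i j; rewrite !mxE.
  elim/ord5_ind: i; elim/ord5_ind: j; rewrite /= ?(e15, e24, e33, e42, e51, e52,
    e54, e55, e44, e45, e25, e31, e32, e34, e35); by field.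
(* Seven summands are peeled off; the remaining three are the nilradical element handled by [LV]. *)
do 7![apply: (LD); last by apply: LZ; first [assumption|apply: LB]].
exact: LV.
Qed.

End Orthogonal.

Theorem theorem4p5 (R : realType) :
  lie_isomorphic (@amsy R) (@sp (complex R) 2).
Proof.
exists (@ext_root _).
split=> [a X Y _ _|X Y /amsy_so sX /amsy_so sY|X _|X Y|Z sZ].
- exact: ext_root_linear.
(* Compatibility with brackets is transported from [ext_square] to its inverse, using that sp_4 is
   closed under brackets. *)
- rewrite -{1}(ext_rootK sX) -{1}(ext_rootK sY).
  rewrite -(ext_square_bracket (ext_root_sp X) (ext_root_sp Y)) ext_squareK //.
  have [_ _ spB] := form_lie_subalgebra (symplectic_form R[i] 2).
  by apply: spB; apply: ext_root_sp.
- exact: ext_root_sp.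
- by move=> /amsy_so sX /amsy_so sY eXY; rewrite -(ext_rootK sX) eXY ext_rootK.
- exists (ext_square Z); last exact: ext_squareK.
  by apply: so_amsy; apply: ext_square_so.
Qed.
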